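(* Let $p$ be a prime. Given any integer $\ell>1$, for each $k>0$ we have $$\widetilde{\mathrm{H}}_{k-1}(\mathrm{SPB}_{2k}(\mathbb Z/p^\ell,p);\mathbb F_p)\neq 0.$$ Given any number ring $\mathcal O$ (ring of integers in a number field) and any prime power $p^a>2$, for each $k>0$ we have $$\text{either}\quad\widetilde{\mathrm{H}}_{k-1}(\mathrm{SPB}_{2k}(\mathcal O,p^a);\mathbb F_p)\ne 0\quad\text{or}\quad\widetilde{\mathrm{H}}_{k-1}(\mathrm{SPB}_{2k+1}(\mathcal O,p^a);\mathbb F_p)\neq 0.$$
   Context: Let $R$ be a ring, $I\subset R$ an ideal, $e_1,\dots,e_n$ the standard basis of $R^n$ and $\lambda_1,\dots,\lambda_n:R^n\to R$ the dual basis. $\mathrm{SU}_n(R)$ is the simplicial complex whose vertices are pairs $(v\in R^n,\ g:R^n\twoheadrightarrow R)$, $g$ linear, with $g(v)=1$; a collection $\{(v_1,g_1),\dots,(v_k,g_k)\}$ is a $(k-1)$-simplex iff $v_1,\dots,v_k$ are linearly independent and $g_i(v_j)=\delta_{ij}$. $\mathrm{SU}_n(R,I)$ is the full subcomplex on vertices $(v,g)$ for which there exists $i\in\{1,\dots,n\}$ with $v\equiv e_i\bmod I$ and $g\equiv\lambda_i\bmod I$. The complex of mod-$I$ split partial bases $\mathrm{SPB}_n(R,I)$ is the subcomplex of $\mathrm{SU}_n(R,I)$ consisting of those simplices contained in an $(n-1)$-simplex of $\mathrm{SU}_n(R,I)$. For $x\in R$, $\mathrm{SPB}_n(R,x)$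 means $\mathrm{SPB}_n(R,xR)$. $\widetilde{\mathrm{H}}$ denotes reduced homology; ''or'' is inclusive. *)

(* Defs.v *)
From HB Require Import structures.
From mathcomp Require Import all_boot all_order all_algebra all_field.
From mathcomp Require Import finmap monalg.
From mathcomp Require Import boolp wochoice.

Set Implicit Arguments.
Unset Strict Implicit.
Unset Printing Implicit Defensive.

Import GRing.Theory.

Local Open Scope fset_scope.
Local Open Scope quotient_scope.
Local Open Scope ring_scope.

(* Abstract simplicial complexes. A face with m elements is an (m-1)-simplex;
   in particular the empty face is the (-1)-simplex. *)
Record scomplex (T : choiceType) := SComplex {
  face :> {fset T} -> Prop;
  face_sub : forall s t : {fset T}, t `<=` s -> face s -> face t }.

Section ReducedHomology.
Variables (F : nzRingType) (T : choiceType) (X : scomplex T).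

(* Simplices are oriented by a total order on the vertices, fixed once and
   for all by choice; any well-order is total. *)
Definition vle : rel T := sval (well_ordering_principle T).

Definition vpos (s : {fset T}) (x : T) : nat :=
  #|` [fset y in s | (y != x) && vle y x] |.

(* d [x_0 < ... < x_m] = \sum_i (-1)^i [x_0 < .. (x_i omitted) .. < x_m].
   On a vertex this is the augmentation: d [x_0] is the empty face. *)
Definition bd_simplex (s : {fset T}) : {malg F[{fset T}]} :=
  \sum_(x <- s) << (-1) ^+ vpos s x *g s `\ x >>.

Definition bd (c : {malg F[{fset T}]}) : {malg F[{fset T}]} :=
  \sum_(s <- msupp c) c@_s *: bd_simplex s.

Lemma bd_widen (D : {fset {fset T}}) c : msupp c `<=` D ->
  bd c = \sum_(s <- D) c@_s *: bd_simplex s.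
Proof.
move=> sub; rewrite /bd (big_fset_incl _ sub) //= => s _ sc.
by rewrite (mcoeff_outdom sc) scale0r.
Qed.

Lemma bd_is_linear : linear bd.
Proof.
move=> a u v.
pose D := msupp u `|` msupp v.
have sD : msupp (a *: u + v) `<=` D.
  apply: fsubset_trans (msuppD_le _ _) _; apply: fsetSU; exact: msuppZ_le.
rewrite (bd_widen sD) (@bd_widen D u) ?fsubsetUl // (@bd_widen D v) ?fsubsetUr //.
rewrite scaler_sumr -big_split /=; apply: eq_bigr => s _.
by rewrite mcoeffD mcoeffZ scalerDl scalerA.
Qed.

HB.instance Definition _ := GRing.isLinear.Build F
  {malg F[{fset T}]} {malg F[{fset T}]} *:%R bd bd_is_linear.

Definition is_chain (d : nat) : {pred {malg F[{fset T}]}} := fun c =>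
  `[< forall s, s \in msupp c -> X s /\ #|` s| = d.+1 >].

Definition is_cycle (d : nat) : {pred {malg F[{fset T}]}} := fun c =>
  (c \in is_chain d) && (bd c == 0).

Lemma is_chain_closed d : zmod_closed (is_chain d).
Proof.
split=> [|u v /asboolP hu /asboolP hv]; apply/asboolP => s.
  by rewrite msupp0.
by move/(fsubsetP (msuppB_le _ _)); rewrite in_fsetU => /orP[/hu|/hv].
Qed.

HB.instance Definition _ d :=
  GRing.isZmodClosed.Build _ (is_chain d) (is_chain_closed d).

Lemma is_cycle_closed d : zmod_closed (is_cycle d).
Proof.
split=> [|u v /andP[cu /eqP du] /andP[cv /eqP dv]]; apply/andP.
  by rewrite rpred0 linear0.
by rewrite rpredB // linearB /= du dv subr0.
Qed.

HB.instance Definition _ d :=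
  GRing.isZmodClosed.Build _ (is_cycle d) (is_cycle_closed d).

Record cycles (d : nat) :=
  Cycle { cycle_val :> {malg F[{fset T}]}; _ : cycle_val \in is_cycle d }.

HB.instance Definition _ d := [isSub for @cycle_val d].
HB.instance Definition _ d := [Choice of cycles d by <:].
HB.instance Definition _ d := [SubChoice_isSubZmodule of cycles d by <:].

Definition is_boundary (d : nat) : {pred cycles d} := fun z =>
  `[< exists2 b, b \in is_chain d.+1 & bd b = \val z >].
Arguments is_boundary : clear implicits.

Lemma is_boundary_closed d : zmod_closed (is_boundary d).
Proof.
split=> [|u v /asboolP[b cb bu] /asboolP[c cc cv]]; apply/asboolP.
  by exists 0; rewrite ?rpred0 ?linear0.
by exists (b - c); rewrite ?rpredB // linearB /= bu cv.
Qed.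

HB.instance Definition _ d :=
  GRing.isZmodClosed.Build _ (is_boundary d) (is_boundary_closed d).

(* The reduced simplicial homology group of X in degree d >= 0, with
   coefficients in F, as an additive group. *)
Definition reduced_homology (d : nat) : zmodType :=
  Quotient.quot (is_boundary d).

Lemma reduced_homology_neq0 d :
  (exists h : reduced_homology d, h != 0) <->
  (exists2 z, z \in is_cycle d & forall b, b \in is_chain d.+1 -> bd b <> z).
Proof.
have quot0 (z : cycles d) :
    (\pi_(Quotient.quot (is_boundary d)) z == 0) = (z \in is_boundary d).
  by rewrite -[z in RHS]subr0 Quotient.idealrBE raddf0.
split=> [[h]|[z cz nz]].
  rewrite -[h]reprK quot0 => nz; exists (val (repr h)); first exact: valP.
  by move=> b cb eb; case/negP: nz; apply/asboolP; exists b.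
exists (\pi_(Quotient.quot (is_boundary d)) (Cycle cz)); rewrite quot0.
by apply/negP => /asboolP[b cb eb]; exact: (nz b).
Qed.

End ReducedHomology.

Section SplitUnimodular.
Variables (R : nzRingType) (n : nat).

(* R^n is 'rV[R]_n, and a linear form g on R^n is the column of its values on
   the standard basis, so that g(v) is the entry of v *m g. Then e_i is
   delta_mx 0 i and its dual form lambda_i is delta_mx i 0. *)
Definition form_app (g : 'cV[R]_n) (v : 'rV[R]_n) : R := (v *m g) 0 0.

Notation vertex := ('rV[R]_n * 'cV[R]_n)%type.

Definition is_vertex (x : vertex) : Prop :=
  (forall r, exists u, form_app x.2 u = r) /\ form_app x.2 x.1 = 1.

(* The family of first components, indexed by the elements of s. *)
Definition lin_indep (s : {fset vertex}) : Prop :=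
  forall a : vertex -> R, \sum_(x <- s) a x *: x.1 = 0 ->
  forall x, x \in s -> a x = 0.

Definition SU_face (s : {fset vertex}) : Prop :=
  [/\ forall x, x \in s -> is_vertex x, lin_indep s &
      forall x y, x \in s -> y \in s -> form_app x.2 y.1 = (x == y)%:R].

Lemma SU_face_sub (s t : {fset vertex}) : t `<=` s -> SU_face s -> SU_face t.
Proof.
move=> ts [vs ls ds]; have ts' := fsubsetP ts.
split=> [x /ts' /vs // | a a0 x xt | x y /ts' xs /ts']; last exact: ds.
pose b y := if y \in t then a y else 0.
have: b x = 0; last by rewrite /b xt.
apply: ls (ts' x xt); rewrite -[RHS]a0; apply/esym.
have E : \sum_(y <- t) a y *: y.1 = \sum_(y <- t) b y *: y.1.
  by apply: eq_big_seq => y yt; rewrite /b yt.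
rewrite E (big_fset_incl _ ts) //= => y _ /negbTE yt.
by rewrite /b yt scale0r.
Qed.

Definition SU : scomplex vertex := SComplex SU_face_sub.

(* Meant to be the membership predicate of an ideal. *)
Variable I : R -> Prop.

Definition mx_congr (p q : nat) (A B : 'M[R]_(p, q)) : Prop :=
  forall i j, I (A i j - B i j).

Definition std_mod (x : vertex) : Prop :=
  exists i : 'I_n, mx_congr x.1 (delta_mx 0 i) /\ mx_congr x.2 (delta_mx i 0).

Definition SUI_face (s : {fset vertex}) : Prop :=
  SU s /\ forall x, x \in s -> std_mod x.

Lemma SUI_face_sub (s t : {fset vertex}) : t `<=` s -> SUI_face s -> SUI_face t.
Proof.
move=> ts [fs ms]; split; first exact: face_sub ts fs.
by move=> x /(fsubsetP ts); apply: ms.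
Qed.

Definition SUI : scomplex vertex := SComplex SUI_face_sub.

Definition SPB_face (s : {fset vertex}) : Prop :=
  exists t, [/\ s `<=` t, SUI t & #|` t| = n].

Lemma SPB_face_sub (s t : {fset vertex}) : t `<=` s -> SPB_face s -> SPB_face t.
Proof. by move=> ts [u [su fu cu]]; exists u; split=> //; apply: fsubset_trans su. Qed.

Definition SPB : scomplex vertex := SComplex SPB_face_sub.

End SplitUnimodular.

Definition principal (R : nzRingType) (x : R) : R -> Prop :=
  fun y => exists r, y = x * r.

Section RingOfIntegers.
Variable K : fieldExtType rat.

Definition integral_over_Z : {pred K} :=
  fun x => `[< integralOver (intr : int -> K) x >].

Lemma integral_subring_closed : subring_closed integral_over_Z.
Proof.
split=> [|x y /asboolP hx /asboolP hy|x y /asboolP hx /asboolP hy]; apply/asboolP.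
- exact: integral1.
- exact: integral_sub.
- exact: integral_mul.
Qed.

HB.instance Definition _ :=
  GRing.isSubringClosed.Build K integral_over_Z integral_subring_closed.

Record ring_of_integers :=
  RingOfIntegers { alg_int :> K; _ : alg_int \in integral_over_Z }.

HB.instance Definition _ := [isSub for alg_int].
HB.instance Definition _ := [Choice of ring_of_integers by <:].
HB.instance Definition _ := [SubChoice_isSubComNzRing of ring_of_integers by <:].

End RingOfIntegers.

(* Main.v *)
From HB Require Import structures.
Require Import Defs.
From mathcomp Require Import all_boot all_order all_algebra all_field.
From mathcomp Require Import finmap monalg.
From mathcomp Require Import boolp classical_sets wochoice.
From mathcomp Require Import ring.

(** Write I = xR, where x is p or p^a. A vertex (v, g) of SPB_{2k}(R, I) has a
    unique colour i, the index with v = e_i and g = lambda_i modulo I, and the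
    vertices of a simplex have different colours. Complete a simplex to a facet
    and let 1 + B be the matrix with rows its vectors; then B has entries in I,
    and the forms are the columns of (1 + B)^-1 = 1 - B modulo I^2. Hence the
    vertex of colour i determines modulo I^2 the i-th row of B, through v, and
    the i-th column of B, through g.

    Group the colours into k blocks {2j, 2j+1}, and fix an additive map
    theta : I / I^2 -> F_p with theta(x) = 1. Label a vertex whose colour lies
    in block j by theta(B_{2j,2j+1}): this entry of B can be read from the row
    if the colour is 2j and from the column if it is 2j+1, and
    [label_same_block] says that two adjacent vertices in the same block have
    the same label. Sending a vertex to its block and label is therefore a
    simplicial map from SPB_{2k}(R, I) to the k-fold join of the discrete set
    F_p, a complex of dimension k-1. A (k-1)-cycle whose image is nonzero cannot
    be a boundary, as its image lives in top dimension.

    Such a cycle is the cross-polytope formed by the k pairs of vertices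
    (e_{2j} + x e_{2j+1}, lambda_{2j}) and (e_{2j}, lambda_{2j}), which have
    labels 1 and 0 in block j. Its facets are parts of unipotent frames
    ([vert_SPB]).

    The map to the join is used through the cocycle that it induces: send a
    vertex with label t in block j to the point t on the j-th coordinate axis of
    F_p^k, and take the determinant of k such points. Orientations are handled
    by viewing oriented chains as an exterior algebra, in which the boundary is
    the contraction by the constant function 1, the cross-polytope is a product
    of differences of vertices, and the determinant is an iterated contraction
    by the coordinates. All signs are then contained in the antiderivation rule
    [contr_wedge], and [sphere_homology_neq0] is the resulting criterion.

    The functional theta exists as soon as p divides x and x is not in pxR
    ([ideal_functional]). For number rings this gives a nonzero class already in
    SPB_{2k}(R, I). *)

Set Implicit Arguments.
Unset Strict Implicit.
Unset Printing Implicit Defensive.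

Import GRing.Theory Num.Theory.

Local Open Scope fset_scope.
Local Open Scope ring_scope.

(** * The exterior algebra of oriented simplices *)

Section SimplexOperators.
Variables (F : comNzRingType) (T : choiceType).
Local Notation chain := {malg F[{fset T}]}.

Definition lin_ext (f : {fset T} -> chain) (c : chain) : chain :=
  \sum_(s <- msupp c) c@_s *: f s.

Lemma lin_ext_widen f (D : {fset {fset T}}) c : msupp c `<=` D ->
  lin_ext f c = \sum_(s <- D) c@_s *: f s.
Proof.
move=> sub; rewrite /lin_ext (big_fset_incl _ sub) //= => s _ sc.
by rewrite (mcoeff_outdom sc) scale0r.
Qed.

Lemma lin_ext_is_linear f : linear (lin_ext f).
Proof.
move=> a u v; pose D := msupp u `|` msupp v.
have sD : msupp (a *: u + v) `<=` D.
  by apply: fsubset_trans (msuppD_le _ _) _; apply: fsetSU; exact: msuppZ_le.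
rewrite !(@lin_ext_widen f D) ?fsubsetUl ?fsubsetUr //.
rewrite scaler_sumr -big_split /=; apply: eq_bigr => s _.
by rewrite mcoeffD mcoeffZ scalerDl scalerA.
Qed.

HB.instance Definition _ f :=
  GRing.isLinear.Build F chain chain *:%R (lin_ext f) (lin_ext_is_linear f).

Lemma scale_malgU (a b : F) (s : {fset T}) :
  a *: << b *g s >> = << a * b *g s >>.
Proof. by apply/malgP => t; rewrite mcoeffZ mcoeffU mcoeffU -mulrnAr. Qed.

Lemma lin_extU f a s : lin_ext f << a *g s >> = a *: f s.
Proof. by rewrite (lin_ext_widen f msuppU_le) big_seq_fset1 mcoeffUU. Qed.

(** Contraction by a function [a] on the vertices; the boundary of the simplex
    is the case where [a] is constantly 1. *)
Definition contr_simplex (a : T -> F) (s : {fset T}) : chain :=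
  \sum_(v <- s) << a v * (-1) ^+ vpos s v *g s `\ v >>.

(** Left multiplication by the vertex [v]: the sign sorts [v] into the
    orientation of [s], and a repeated vertex gives zero. *)
Definition wedge_simplex (v : T) (s : {fset T}) : chain :=
  if v \in s then 0 else << (-1) ^+ vpos s v *g v |` s >>.

End SimplexOperators.

HB.lock Definition contr (F : comNzRingType) (T : choiceType) (a : T -> F)
  (c : {malg F[{fset T}]}) := lin_ext (contr_simplex a) c.
HB.lock Definition wedge (F : comNzRingType) (T : choiceType) (v : T)
  (c : {malg F[{fset T}]}) := lin_ext (wedge_simplex F v) c.

Section ExteriorAlgebra.
Variables (F : comNzRingType) (T : choiceType).
Local Notation chain := {malg F[{fset T}]}.
Implicit Types (a : T -> F) (x y v : T) (s t : {fset T}) (c d : chain).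

Fact contr_is_linear a : linear (@contr F T a).
Proof. by move=> b u v; rewrite contr.unlock; exact: linearP. Qed.

HB.instance Definition _ a :=
  GRing.isLinear.Build F chain chain *:%R (contr a) (contr_is_linear a).

Fact wedge_is_linear v : linear (@wedge F T v).
Proof. by move=> b c d; rewrite wedge.unlock; exact: linearP. Qed.

HB.instance Definition _ v :=
  GRing.isLinear.Build F chain chain *:%R (wedge v) (wedge_is_linear v).

Lemma contrU a (b : F) s :
  contr a << b *g s >> = b *: contr_simplex a s.
Proof. by rewrite contr.unlock lin_extU. Qed.

Lemma wedgeU v (b : F) s :
  wedge v << b *g s >> = b *: wedge_simplex F v s.
Proof. by rewrite wedge.unlock lin_extU. Qed.

Lemma chain_ind (P : chain -> Prop) :
  P 0 -> (forall c d, P c -> P d -> P (c + d)) ->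
  (forall (b : F) s, P << b *g s >>) -> forall c, P c.
Proof. by move=> P0 PD PU c; rewrite [c]monalgE; elim/big_ind: _ => // s _. Qed.

Lemma bd_contr (c : chain) : bd c = contr (fun=> 1) c.
Proof.
rewrite contr.unlock /bd; apply: eq_bigr => s _; congr (_ *: _).
by rewrite /bd_simplex /contr_simplex; apply: eq_bigr => v _; rewrite mul1r.
Qed.

Lemma vleNge (x y : T) : x != y -> vle y x = ~~ vle x y.
Proof.
rewrite /vle; case: well_ordering_principle => R /= /withinW woR xy.
have tot := wo_chainW (woR predT).
have anti := wo_chain_antisymmetric (woR predT).
apply/idP/idP => [Ryx|]; last by have /orP[->|] := tot x y isT isT.
by apply: contra_neqN xy => Rxy; apply: anti; rewrite ?Rxy.
Qed.

Lemma vpos_setU1 (s : {fset T}) x y : y \notin s ->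
  vpos (y |` s) x = (((y != x) && vle y x) + vpos s x)%N.
Proof.
move=> ys; rewrite /vpos.
have -> : [fset z in y |` s | (z != x) && vle z x] =
   if (y != x) && vle y x then y |` [fset z in s | (z != x) && vle z x]
   else [fset z in s | (z != x) && vle z x].
  apply/fsetP => z; case: ifP => e; rewrite !inE; case: eqVneq => [->|] //=.
  by rewrite e (negPf ys).
by case: ifP => // _; rewrite cardfsU1 !inE (negPf ys).
Qed.

Lemma vpos_setD1 (s : {fset T}) x y : y \in s ->
  vpos s x = (((y != x) && vle y x) + vpos (s `\ y) x)%N.
Proof. by move=> ys; rewrite -vpos_setU1 ?fsetD11 // fsetD1K. Qed.

Lemma vpos_setD1v (s : {fset T}) x : vpos (s `\ x) x = vpos s x.
Proof.
have [xs|xs] := boolP (x \in s); last by rewrite mem_fsetD1.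
by rewrite (vpos_setD1 x xs) eqxx.
Qed.

(** Contraction is an antiderivation of the exterior algebra. The signs work
    because, of two distinct vertices [v] and [w], exactly one precedes the
    other: removing [v] before [w] or after it changes the number of transposed
    positions by one. The rule includes simplices [s] through [v], so that
    arbitrary products can be contracted factor by factor. *)
Lemma contr_wedge a v c :
  contr a (wedge v c) = a v *: c - wedge v (contr a c).
Proof.
elim/chain_ind: c => [|c d Ec Ed|b s].
- by rewrite !raddf0 addr0.
- by rewrite !linearD /= Ec Ed addrACA.
suff E : contr a (wedge_simplex F v s) =
         a v *: << s >> - wedge v (contr_simplex a s).
  rewrite contrU wedgeU !linearZ /=.
  by rewrite E scalerBr !scale_malgU !mulr1 mulrC scalerN.
rewrite /wedge_simplex /contr_simplex (linear_sum (wedge v)) /=.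
case: ifPn => vs.
  (* v occurs in s: only the term of v \wedge contr a s in which contr
     removes v survives, and it cancels a v *: s. *)
  rewrite (big_fsetD1 v) //= big_seq big1 => [|w]; last first.
    rewrite !inE => /andP[wv ws].
    by rewrite wedgeU /wedge_simplex !inE eq_sym wv vs scaler0.
  rewrite linear0 addr0 wedgeU /wedge_simplex fsetD11.
  rewrite vpos_setD1v fsetD1K // !scale_malgU mulr1 -mulrA -expr2.
  by rewrite sqrr_sign mulr1 subrr.
rewrite contrU /contr_simplex big_fsetU1 // scalerDr.
rewrite (vpos_setU1 _ vs) eqxx add0n (fsetU1K vs).
rewrite scale_malgU mulrCA -expr2 sqrr_sign -scale_malgU.
apply: (f_equal (+%R _)).
rewrite scaler_sumr -sumrN; apply: eq_big_seq => w ws.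
have wv : w != v by apply: contraNneq vs => <-.
rewrite wedgeU /wedge_simplex !inE (negPf vs) andbF.
rewrite !scale_malgU -monalgUN.
have -> : (v |` s) `\ w = v |` s `\ w.
  apply/fsetP => u; rewrite !inE.
  by case: (eqVneq u v) wv => // ->; rewrite eq_sym => ->.
congr << _ *g _ >>.
rewrite (vpos_setD1 v ws) vpos_setU1 // wv eq_sym wv /= (vleNge wv).
rewrite mulrCA -mulrA -mulrN; congr (_ * _).
by case: (vle w v); rewrite /= ?add0n ?add1n exprS mulN1r ?mulNr ?mulrN mulrC.
Qed.

Lemma msupp_wedge v (c : chain) s : s \in msupp (wedge v c) ->
  exists t, [/\ t \in msupp c, v \notin t & s = v |` t].
Proof.
rewrite -mcoeff_neq0; apply: contra_neqP => noface.
rewrite wedge.unlock /lin_ext raddf_sum big_seq big1 //= => t tc.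
rewrite mcoeffZ /wedge_simplex; case: ifPn => [_|vt].
  by rewrite mcoeff0 mulr0.
rewrite mcoeffU; case: eqVneq => [vts|_]; last by rewrite mulr0.
by case: noface; exists t.
Qed.

Lemma mcoeff_wedge0 v (c : chain) : (wedge v c)@_fset0 = 0.
Proof.
apply/eqP; rewrite mcoeff_eq0; apply/negP => /msupp_wedge[t [_ _ /fsetP/(_ v)]].
by rewrite !inE eqxx.
Qed.

Lemma contr0 a : contr a << fset0 >> = 0 :> chain.
Proof. by rewrite contrU /contr_simplex big_seq_fset0 scaler0. Qed.

(** Multiplication by [x - y], that is, the join with the 0-sphere {x, y}. *)
Definition susp x y (c : chain) : chain := wedge x c - wedge y c.

Lemma susp0 x y : susp x y 0 = 0.
Proof. by rewrite /susp (raddf0 (wedge x)) (raddf0 (wedge y)) subr0. Qed.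

Lemma suspN x y c : susp x y (- c) = - susp x y c.
Proof. by rewrite /susp (raddfN (wedge x)) (raddfN (wedge y)) opprD. Qed.

Lemma contr_susp a x y c :
  contr a (susp x y c) = (a x - a y) *: c - susp x y (contr a c).
Proof.
rewrite /susp (raddfB (contr a)) /= !contr_wedge scalerBl.
by rewrite !opprD !opprK addrACA.
Qed.

(** The coefficient of [fset0] in [contrs a js << s >>] is, up to sign, the
    determinant of the matrix of the values [a j v] when [s] has as many
    vertices as [js] has entries. *)
Definition contrs (J : Type) (a : J -> T -> F) (js : seq J) c : chain :=
  foldl (fun d j => contr (a j) d) c js.

(** Functions that agree at [x] and [y] kill [x - y], so that contracting by
    them leaves the factor [x - y] untouched; a multiple of [x - y] has no
    component in degree zero. *)
Lemma mcoeff_contrs_susp J (a : J -> T -> F) js x y c :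
  (forall j, a j x = a j y) -> (contrs a js (susp x y c))@_fset0 = 0.
Proof.
move=> axy; elim: js c => [|j js IH] c /=.
  by rewrite mcoeffB !mcoeff_wedge0 subrr.
by rewrite contr_susp axy subrr scale0r sub0r -suspN.
Qed.

(** A determinant with two equal rows vanishes. The reduction to
    [mcoeff_contrs_susp] is the row operation: as [y * y = 0], the simplex
    [s = x * y * t] is also [(x - y) * (y * t)]. *)
Lemma mcoeff_contrs_face J (a : J -> T -> F) js (s : {fset T}) x y :
  x \in s -> y \in s -> x != y -> (forall j, a j x = a j y) ->
  (contrs a js << s >>)@_fset0 = 0.
Proof.
move=> xs ys xy axy.
have -> : << s >> = susp x y << (-1) ^+ vpos s x *g s `\ x >> :> chain.
  have W0 : wedge y << (-1) ^+ vpos s x *g s `\ x >> = 0 :> chain.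
    by rewrite wedgeU /wedge_simplex !inE ys eq_sym xy scaler0.
  rewrite /susp W0 subr0 wedgeU /wedge_simplex fsetD11 scale_malgU.
  by rewrite vpos_setD1v (fsetD1K xs) -expr2 sqrr_sign.
exact: mcoeff_contrs_susp.
Qed.

Section Sphere.
Variables (J : eqType) (vert : J -> bool -> T).

(** The product of the differences [vert j false - vert j true], i.e. the
    fundamental cycle of a cross-polytope. *)
Definition sphere (js : seq J) : chain :=
  foldr (fun j c => susp (vert j false) (vert j true) c) << fset0 >> js.

Lemma contr_sphere a js :
  {in js, forall j, a (vert j false) = a (vert j true)} ->
  contr a (sphere js) = 0.
Proof.
elim: js => [_|j js IH eqa] /=; first exact: contr0.
rewrite contr_susp eqa ?mem_head // subrr scale0r sub0r.
rewrite IH => [|i ijs]; last by apply: eqa; rewrite inE ijs orbT.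
by rewrite susp0 oppr0.
Qed.

(** If the [a i] separate the two ends of the [i]-th axis and no others, then
    each contraction removes exactly one factor of the product. *)
Lemma contrs_sphere (a : J -> T -> F) js : uniq js ->
  (forall i j, a i (vert j false) - a i (vert j true) = (i == j)%:R) ->
  contrs a js (sphere js) = << fset0 >>.
Proof.
move=> ujs aE; elim: js ujs => //= j js IH /andP[jjs /IH E].
rewrite contr_susp aE eqxx scale1r contr_sphere => [|i ijs].
  by rewrite susp0 subr0 E.
by apply/subr0_eq; rewrite aE; case: eqVneq ijs jjs => // -> ->.
Qed.

Lemma msupp_sphere js s : uniq js -> s \in msupp (sphere js) ->
  #|` s| = size js /\ exists e, {subset s <= [seq vert j (e j) | j <- js]}.
Proof.
elim: js s => [|j js IH] s /=.
  move=> _ /(fsubsetP msuppU_le); rewrite inE => /eqP ->; rewrite cardfs0.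
  by split=> //; exists xpredT => v; rewrite inE.
move=> /andP[jjs ujs] /(fsubsetP (msuppB_le _ _)); rewrite in_fsetU => sv.
have {sv}[b /msupp_wedge[t [/(IH _ ujs)[<- [e te]] vt ->]]] :
    exists b, s \in msupp (wedge (vert j b) (sphere js)).
  by case/orP: sv; [exists false | exists true].
rewrite cardfsU1 vt; split=> //.
exists (fun i => if i == j then b else e i) => v.
rewrite !inE eqxx => /orP[-> //|/te vjs]; apply/orP; right.
have /mapP[i ijs ->] := vjs; apply/mapP; exists i => //.
by case: eqVneq ijs jjs => // -> ->.
Qed.

End Sphere.

Lemma contrs_is_linear J (a : J -> T -> F) js : linear (contrs a js).
Proof.
elim: js => [|j js IH] b u v //=; rewrite -IH.
by rewrite linearP.
Qed.

HB.instance Definition _ J (a : J -> T -> F) js :=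
  GRing.isLinear.Build F chain chain *:%R (contrs a js) (contrs_is_linear a js).

Lemma mcoeff_contrs J (a : J -> T -> F) js c :
  (contrs a js c)@_fset0 =
  \sum_(s <- msupp c) c@_s * (contrs a js << s >>)@_fset0.
Proof.
rewrite [c in LHS]monalgE linear_sum raddf_sum; apply: eq_bigr => s _ /=.
by rewrite -[c@_s in LHS]mulr1 -scale_malgU linearZ /= mcoeffZ.
Qed.

(** The functions [a] define the cocycle [c |-> (contrs a js c)@_fset0], which
    is 1 on the cross-polytope. It vanishes on the boundary of a simplex with
    [k.+2] vertices by [mcoeff_contrs_face], because the boundary is one more
    contraction, by the constant function 1, under which all vertices agree. *)
Lemma sphere_homology_neq0 (X : scomplex T) k
    (vert : 'I_k.+1 -> bool -> T) (a : 'I_k.+1 -> T -> F) :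
  (forall i j, a i (vert j false) - a i (vert j true) = (i == j)%:R) ->
  (forall e s, {subset s <= [seq vert j (e j) | j : 'I_k.+1]} -> X s) ->
  (forall s, X s -> #|` s| = k.+2 ->
     exists x y, [/\ x \in s, y \in s, x != y & forall j, a j x = a j y]) ->
  exists h : reduced_homology F X k, h != 0.
Proof.
move=> aE Xvert agree; pose js := enum 'I_k.+1.
apply/reduced_homology_neq0; exists (sphere vert js).
  apply/andP; split; last by rewrite bd_contr contr_sphere.
  apply/asboolP => s /(msupp_sphere (enum_uniq _))[-> [e se]].
  by rewrite size_enum_ord; split=> //; apply: Xvert se.
move=> b /asboolP bX bdb.
have : (contrs a js (sphere vert js))@_fset0 = 1.
  by rewrite contrs_sphere ?enum_uniq // mcoeffUU.
rewrite -bdb bd_contr.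
(* The k.+1 functions a j together with the constant 1, indexed by None. *)
pose a1 (o : option 'I_k.+1) := if o is Some j then a j else fun=> 1.
have contrs_some l c : contrs a l c = contrs a1 (map Some l) c.
  by elim: l c => //= j l IH c; apply: IH.
rewrite contrs_some -[contrs _ _ _]/(contrs a1 (None :: map Some js) b).
rewrite mcoeff_contrs big_seq big1 => [/eqP|s sb].
  by rewrite eq_sym oner_eq0.
have [Xs cs] := bX s sb; have [x [y [xs ys xy axy]]] := agree s Xs cs.
by rewrite (mcoeff_contrs_face _ xs ys xy) ?mulr0 //; case.
Qed.

End ExteriorAlgebra.

(** * Functionals with values in the prime field *)

Section FpFunctional.
Variables (p : nat) (p_prime : prime p) (V : zmodType).

(** A subgroup containing all multiples of [p]: a subspace of the
    [F_p]-vector space [V / pV]. *)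
Definition p_subgroup (M : V -> Prop) : Prop :=
  (forall v w, M v -> M w -> M (v - w)) /\ (forall v, M (v *+ p)).

Lemma p_subgroup0 M : p_subgroup M -> M 0.
Proof. by case=> _ /(_ 0); rewrite mul0rn. Qed.

Lemma p_subgroupN M v : p_subgroup M -> M v -> M (- v).
Proof.
by move=> HM Mv; rewrite -sub0r; apply: HM.1 => //; apply: p_subgroup0.
Qed.

Lemma p_subgroupD M v w : p_subgroup M -> M v -> M w -> M (v + w).
Proof.
by move=> HM Mv Mw; rewrite -[w]opprK; apply: HM.1 => //; apply: p_subgroupN.
Qed.

Lemma p_subgroupMn M v n : p_subgroup M -> M v -> M (v *+ n).
Proof.
move=> HM Mv; elim: n => [|n IH]; first by rewrite mulr0n; apply: p_subgroup0.
by rewrite mulrS; apply: p_subgroupD.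
Qed.

(** In [V / pV] the integers prime to [p] act invertibly. *)
Lemma p_subgroup_divn M v n :
  p_subgroup M -> ~~ (p %| n)%N -> M (v *+ n) -> M v.
Proof.
move=> HM pn Mvn.
have n_gt0 : (0 < n)%N by case: n pn {Mvn} => //; rewrite dvdn0.
have cop : coprime n p by rewrite coprime_sym prime_coprime.
case: (egcdnP p n_gt0) => i j E _; move: E; rewrite (eqP cop) => E.
have -> : v = v *+ n *+ i - v *+ j *+ p.
  by rewrite -!mulrnA mulnC E mulrnDr addrC addKr.
by apply: HM.1; [apply: p_subgroupMn | apply: HM.2].
Qed.

(** Zorn's lemma; the proof of [Fp_functional] shows that [M] is a hyperplane
    of [V / pV]. *)
Lemma maximal_p_subgroup (U : V -> Prop) u : p_subgroup U -> ~ U u ->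
  exists M : V -> Prop, [/\ p_subgroup M, forall v, U v -> M v, ~ M u &
    forall N : V -> Prop, p_subgroup N -> (forall v, M v -> N v) -> ~ N u ->
      forall v, N v -> M v].
Proof.
move=> HU nUu.
pose good (M : set V) := [/\ p_subgroup M, forall v, U v -> M v & ~ M u].
(* The empty set is admitted so that the empty chain has an upper bound. *)
have [|M [gM maxM]] := @Zorn_bigcup V (fun M => (M = set0 \/ good M)%classic).
  move=> Fam Fgood Ftot.
  have [[X FX [w Xw]]|empty] := pselect (exists2 X, Fam X & exists w, X w).
    have goodF Y v : Fam Y -> Y v -> good Y by move=> /Fgood[->|].
    right; have [HX UX _] := goodF _ _ FX Xw.
    split=> [|v Uv|[Y FY Yu]]; last 2 first.
    - by exists X => //; apply: UX.
    - by have [_ _] := goodF _ _ FY Yu; apply.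
    split=> [v w' [Y FY Yv] [Z FZ Zw]|v]; last by exists X => //; apply: HX.2.
    have [HY _ _] := goodF _ _ FY Yv; have [HZ _ _] := goodF _ _ FZ Zw.
    have [YZ|ZY] := Ftot Y Z FY FZ.
      by exists Z => //; apply: HZ.1 => //; apply: YZ.
    by exists Y => //; apply: HY.1 => //; apply: ZY.
  left; rewrite -subset0 => v [X FX Xv]; apply: empty.
  by exists X => //; exists v.
have {}gM : good M.
  case: gM => // M0; have : (M `<` U)%classic.
    by rewrite M0; split=> // /(_ 0 (p_subgroup0 HU)).
  by move/maxM; case; right.
have [HM UM nMu] := gM; exists M; split=> // N HN MN nNu v Nv.
have [//|nMv] := pselect (M v); case: (maxM N).
  by split=> // NM; apply: nMv; apply: NM.
by right; split=> // w /UM /MN.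
Qed.

(** A subspace avoiding [u] lies in the kernel of a functional that is 1 at
    [u]. Modulo the maximal subgroup [M], every [v] is an integer multiple of
    [u]: otherwise the subgroup generated by [M] and [v] would still avoid [u].
    The multiple is unique modulo [p], and it is the value of the functional. *)
Lemma Fp_functional (U : V -> Prop) u : p_subgroup U -> ~ U u ->
  exists chi : V -> 'F_p, [/\ {morph chi : v w / v + w},
    forall v, U v -> chi v = 0 & chi u = 1].
Proof.
move=> HU /(maximal_p_subgroup HU)[M [HM UM nMu maxM]].
have span v : exists n : nat, M (v - u *+ n).
  have [Mv|nMv] := pselect (M v); first by exists 0%N; rewrite subr0.
  pose N w := exists n : nat, M (w - v *+ n).
  have HN : p_subgroup N.
    split=> [w w' [n Mw] [n' Mw']|w]; last first.
      by exists 0%N; rewrite subr0; apply: HM.2.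
    (* p.-1 stands for -1, since multiples of p lie in M. *)
    exists (n + n' * p.-1)%N.
    have -> : w - w' - v *+ (n + n' * p.-1) =
              (w - v *+ n) - (w' - v *+ n') - v *+ n' *+ p.
      rewrite -[in RHS](prednK (prime_gt0 p_prime)) mulrS mulrnDr mulrnA.
      by rewrite !opprD opprK addrACA -!addrA addNKr.
    by apply: HM.1; [apply: HM.1 | apply: HM.2].
  have [n Mn] : N u.
    apply: contrapT => nNu; apply: nMv; apply: (maxM N) => // [w Mw|].
      by exists 0%N; rewrite subr0.
    by exists 1%N; rewrite subrr; apply: p_subgroup0.
  have pn : ~~ (p %| n)%N.
    apply/negP => /dvdnP[m E]; apply: nMu; rewrite -(subrK (v *+ n) u).
    by apply: p_subgroupD => //; rewrite E mulrnA; apply: HM.2.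
  have n_gt0 : (0 < n)%N by case: n pn {Mn} => //; rewrite dvdn0.
  have cop : coprime n p by rewrite coprime_sym prime_coprime.
  case: (egcdnP p n_gt0) => i j E _; move: E; rewrite (eqP cop) => E.
  exists i; have -> : v - u *+ i = - ((u - v *+ n) *+ i) - v *+ j *+ p.
    rewrite mulrnBl opprB -!mulrnA mulnC E mulrnDr.
    by rewrite [RHS]addrC -[_ + v *+ 1 - _]addrA addKr.
  by apply: HM.1; [apply: p_subgroupN => //; apply: p_subgroupMn | apply: HM.2].
have uniq m n : M (u *+ m - u *+ n) -> m%:R = n%:R :> 'F_p.
  wlog le_nm : m n / (n <= m)%N => [wl|].
    case/orP: (leq_total n m) => [|le_mn E]; first exact: wl.
    by apply/esym/wl => //; rewrite -opprB; apply: p_subgroupN.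
  rewrite -mulrnBr // => Mu; apply/eqP; rewrite -subr_eq0 -natrB //.
  have [/dvdnP[q ->]|pmn] := boolP (p %| m - n)%N.
    by rewrite natrM pchar_Fp_0 // mulr0.
  by case: nMu; apply: p_subgroup_divn pmn Mu.
pose chi v : 'F_p := (sval (cid (span v)))%:R.
have chiE v n : M (v - u *+ n) -> chi v = n%:R.
  move=> Mn; apply: uniq; have Mc := svalP (cid (span v)).
  have -> : u *+ sval (cid (span v)) - u *+ n =
            (v - u *+ n) - (v - u *+ sval (cid (span v))).
    by rewrite opprB [RHS]addrC subrKA.
  exact: HM.1.
exists chi; split=> [v w|v Uv|].
- have Mv := svalP (cid (span v)); have Mw := svalP (cid (span w)).
  rewrite /chi -natrD; apply: chiE; rewrite mulrnDr opprD addrACA.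
  exact: p_subgroupD.
- by apply: (chiE _ 0%N); rewrite subr0; apply: UM.
by apply: (chiE _ 1%N); rewrite subrr; apply: p_subgroup0.
Qed.

End FpFunctional.

(** * Frames congruent to the standard one *)

Section DualFamilies.
Variables (R : nzRingType) (n : nat) (I : R -> Prop).
Local Notation vertex := ('rV[R]_n * 'cV[R]_n)%type.

Definition coloured (i : 'I_n) (z : vertex) : Prop :=
  mx_congr I z.1 (delta_mx 0 i) /\ mx_congr I z.2 (delta_mx i 0).

(** Duality alone gives everything that a simplex needs: evaluating the forms
    proves linear independence, distinctness, and surjectivity of the forms. *)
Lemma dual_family_facet (b : 'I_n -> vertex) :
  (forall i j, form_app (b i).2 (b j).1 = (i == j)%:R) ->
  (forall i, coloured i (b i)) ->
  SUI n I [fset b i | i : 'I_n] /\ #|` [fset b i | i : 'I_n]| = n.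
Proof.
move=> bdual bcol.
have b_inj : injective b.
  move=> i j bij; apply/eqP; have := bdual i j; rewrite -bij bdual eqxx.
  by case: eqP => // _ /eqP; rewrite oner_eq0.
have dual z w : z \in [fset b i | i : 'I_n] -> w \in [fset b i | i : 'I_n] ->
    form_app z.2 w.1 = (z == w)%:R.
  move=> /imfsetP[i _ ->] /imfsetP[j _ ->]; rewrite bdual.
  by rewrite (inj_eq b_inj).
split; last by rewrite card_imfset //= size_enum_ord.
split=> [|_ /imfsetP[i _ ->]]; last by exists i; apply: bcol.
split=> // [z zt|a a0 z zt].
  have z1 := dual z z zt zt; rewrite eqxx in z1; split=> // r.
  by exists (r *: z.1); rewrite /form_app -scalemxAl mxE [X in _ * X]z1 mulr1.
have : form_app z.2 (\sum_(w <- [fset b i | i : 'I_n]) a w *: w.1) = 0.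
  by rewrite a0 /form_app mul0mx mxE.
rewrite /form_app mulmx_suml summxE (big_fsetD1 z) //= big_seq big1.
  by rewrite addr0 -scalemxAl mxE [X in _ * X](dual z z) // eqxx mulr1.
move=> w; rewrite !inE => /andP[wz wt].
rewrite -scalemxAl mxE [X in _ * X](dual z w) // eq_sym (negPf wz).
by rewrite mulr0.
Qed.

End DualFamilies.

(** * A functional on an ideal that kills its square *)

Section IdealFunctional.
Variables (R : comNzRingType) (p : nat) (p_prime : prime p) (x : R).
Hypothesis p_dvd_x : exists q, x = p%:R * q.
Hypothesis x_notin : forall r, x <> p%:R * x * r.

(** The map [I / I^2 -> F_p], [I = xR], sending [x r] to [chi r], where [chi]
    is a functional on [R] with [chi 1 = 1]. The functional [chi] has to vanish
    on the annihilator of [x] for this to be well defined, on [xR] for it to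
    kill [I^2], and on [pR] because its values lie in [F_p]. All three lie in
    [U = {r | x r \in p x R}], and [1] is not in [U] precisely because [x] is
    not in [p x R]. *)
Lemma ideal_functional : exists theta : R -> 'F_p,
  [/\ forall y z, principal x y -> principal x z ->
        theta (y + z) = theta y + theta z,
      forall y z, principal x y -> principal x z -> theta (y * z) = 0 &
      theta x = 1].
Proof.
have [q xq] := p_dvd_x.
pose U r := exists s, x * r = p%:R * x * s.
have HU : p_subgroup p U.
  split=> [r r' [s rs] [s' rs']|r].
    by exists (s - s'); rewrite mulrBr rs rs' -mulrBr.
  by exists r; rewrite mulrnAr -mulr_natl mulrA.
have nU1 : ~ U 1 by case=> s; rewrite mulr1; apply: x_notin.
have [chi [chiD chiU chi1]] := Fp_functional p_prime HU nU1.
have chi_eq r s : x * r = x * s -> chi r = chi s.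
  move=> rs; rewrite -(subrK s r) chiD chiU ?add0r //.
  by exists 0; rewrite mulrBr rs subrr mulr0.
pose quo y := if pselect (principal x y) is left xy then sval (cid xy) else 0.
have theta_x r : chi (quo (x * r)) = chi r.
  rewrite /quo; case: pselect => [xy|[]]; last by exists r.
  by apply: chi_eq; rewrite -(svalP (cid xy)).
exists (chi \o quo); split=> /= [_ _ [r ->] [s ->]|_ _ [r ->] [s ->]|].
- by rewrite -mulrDr !theta_x chiD.
- rewrite -mulrA theta_x; apply: chiU.
  by exists (r * q * s); rewrite {2}xq; ring.
by rewrite -[x in quo x]mulr1 theta_x.
Qed.

End IdealFunctional.

(** * Labels of coloured vertices *)

Section Blocks.
Variable k : nat.

Fact lo_subproof (j : 'I_k) : (j.*2 < 2 * k)%N.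
Proof. by rewrite mul2n ltn_double. Qed.

Fact hi_subproof (j : 'I_k) : (j.*2.+1 < 2 * k)%N.
Proof. by rewrite mul2n ltn_Sdouble. Qed.

(** The coordinates are paired: the [j]-th block consists of [2j] and [2j+1]. *)
Definition lo j := Ordinal (lo_subproof j).
Definition hi j := Ordinal (hi_subproof j).

Lemma lo_or_hi (i : 'I_(2 * k)) : exists j, i = lo j \/ i = hi j.
Proof.
have ik : (i./2 < k)%N.
  rewrite -ltn_double -[k.*2]mul2n; apply: (leq_ltn_trans _ (ltn_ord i)).
  by rewrite -[leqRHS]odd_double_half leq_addl.
exists (Ordinal ik); have := odd_double_half i.
by case: (odd i) => E; [right | left]; apply: val_inj.
Qed.

Lemma lo_neq_hi i j : lo i != hi j.
Proof. by apply/eqP => /(congr1 (odd \o val)) /=; rewrite !odd_double. Qed.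

Lemma lo_inj : injective lo.
Proof. by move=> i j [/double_inj ij]; apply: val_inj. Qed.

Lemma hi_inj : injective hi.
Proof. by move=> i j [/double_inj ij]; apply: val_inj. Qed.

End Blocks.

Section Labels.
Variables (R F : comNzRingType) (I : R -> Prop) (theta : R -> F) (x : R).
Hypothesis I_add : forall y z, I y -> I z -> I (y + z).
Hypothesis I_mul : forall y z, I y -> I (y * z).
Hypothesis thetaD : forall y z, I y -> I z -> theta (y + z) = theta y + theta z.
Hypothesis thetaM : forall y z, I y -> I z -> theta (y * z) = 0.
Hypothesis I_x : I x.
Hypothesis theta_x : theta x = 1.

Let I0 : I 0. Proof. by rewrite -(mulr0 x); apply: I_mul. Qed.
Let I_sub y z : I y -> I z -> I (y - z).
Proof. by move=> Iy Iz; rewrite -mulrN1; apply: I_add => //; apply: I_mul. Qed.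
Let theta0 : theta 0 = 0.
Proof. by rewrite -(mulr0 0) thetaM. Qed.

Lemma I_proper : ~ I 1.
Proof.
by move=> I1; have /eqP := theta_x; rewrite -[x]mul1r thetaM // eq_sym oner_eq0.
Qed.

Section Dimension.
Variable n : nat.
Local Notation vertex := ('rV[R]_n * 'cV[R]_n)%type.

Lemma coloured_inj i j (z : vertex) :
  coloured I i z -> coloured I j z -> i = j.
Proof.
move=> [/(_ 0 i) zi _] [/(_ 0 i) zj _]; apply/eqP.
apply: contra_notT I_proper => ij.
move: (I_sub zj zi); rewrite !mxE !eqxx (negPf ij) /= subr0.
by rewrite opprB addrCA subrr addr0.
Qed.

(** Since [theta] kills products, [theta_null] contains the square of [I]; it
    plays the role of the congruence modulo [I^2]. *)
Definition theta_null y := I y /\ theta y = 0.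

Lemma theta_null_add y z : theta_null y -> theta_null z -> theta_null (y + z).
Proof.
move=> [Iy y0] [Iz z0].
by split; [apply: I_add | rewrite thetaD // y0 z0 addr0].
Qed.

Lemma theta_nullM y z : I y -> I z -> theta_null (y * z).
Proof. by move=> Iy Iz; split; [apply: I_mul | apply: thetaM]. Qed.

Lemma orthogonal_coloured i j (z w : vertex) :
  coloured I i z -> coloured I j w -> form_app w.2 z.1 = 0 -> i != j.
Proof.
move=> [zi _] [_ wj] wz0; apply: contra_notN I_proper => /eqP ij.
subst j; move: wz0; rewrite /form_app mxE (bigD1 i) //= => wz0.
have {zi}zi m : I (z.1 0 m - (m == i)%:R) by have := zi 0 m; rewrite !mxE.
have Izi := zi i; have := wj i 0; rewrite !mxE !eqxx in Izi * => Iwi.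
set rest := \sum_(m < n | _) _ in wz0.
have Irest : I rest.
  apply: (big_ind I) => // m mi; apply: I_mul.
  by have := zi m; rewrite (negPf mi) subr0.
have -> : 1 = 0 - (z.1 0 i - 1) * w.2 i 0 - (w.2 i 0 - 1) - rest.
  by rewrite -wz0; generalize (z.1 0 i) (w.2 i 0) rest => u v r; ring.
by do !apply: I_sub => //; apply: I_mul.
Qed.

(** The key computation. Modulo [I^2], the only terms of [form_app w.2 z.1]
    that survive are [z_j w_j + z_i w_i = z_j + w_i], because [z_i] and [w_j]
    are 1 modulo [I] and all other coordinates are in [I]. *)
Lemma theta_orthogonal i j (z w : vertex) :
  coloured I i z -> coloured I j w -> form_app w.2 z.1 = 0 ->
  theta (z.1 0 j) = - theta (w.2 i 0).
Proof.
move=> zi wj wz0; have ij := orthogonal_coloured zi wj wz0.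
case: zi wj wz0 => zi _ [_ wj].
have {zi}zi m : I (z.1 0 m - (m == i)%:R) by have := zi 0 m; rewrite !mxE.
have {wj}wj m : I (w.2 m 0 - (m == j)%:R).
  by have := wj m 0; rewrite !mxE andbT.
have Izj : I (z.1 0 j) by have := zi j; rewrite eq_sym (negPf ij) subr0.
have Iwi : I (w.2 i 0) by have := wj i; rewrite (negPf ij) subr0.
rewrite /form_app mxE (bigD1 j) // (bigD1 i) //= => wz0.
apply/eqP; rewrite -addr_eq0 -thetaD //; apply/eqP.
set rest := \sum_(m < n | _) _ in wz0.
suff : theta_null (z.1 0 j + w.2 i 0) by case.
have -> : z.1 0 j + w.2 i 0 =
    z.1 0 j * (1 - w.2 j 0) + (1 - z.1 0 i) * w.2 i 0 - rest.
  by rewrite -[LHS]subr0 -wz0; ring.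
have I1w : I (1 - w.2 j 0).
  by have := I_sub I0 (wj j); rewrite eqxx sub0r opprB.
have I1z : I (1 - z.1 0 i).
  by have := I_sub I0 (zi i); rewrite eqxx sub0r opprB.
apply: theta_null_add.
  by apply: theta_null_add; apply: theta_nullM.
rewrite -sumrN; apply: (big_ind theta_null) => //.
  exact: theta_null_add.
move=> m /andP[mj mi]; rewrite -mulNr; apply: theta_nullM.
  by have := I_sub I0 (zi m); rewrite (negPf mi) subr0 sub0r.
by have := wj m; rewrite (negPf mj) subr0.
Qed.

End Dimension.

Variable k : nat.
Local Notation vertex := ('rV[R]_(2 * k) * 'cV[R]_(2 * k))%type.

(** If [1 + B] is the matrix of the vectors of a facet, with [B] in [I], then
    its forms are the columns of the inverse, which is [1 - B] modulo [I^2]. So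
    both branches read off [theta] of the same entry [B (lo j) (hi j)], the
    first from a row and the second from a column. *)
Definition label (j : 'I_k) (z : vertex) : F :=
  if `[< coloured I (lo j) z >] then theta (z.1 0 (hi j))
  else if `[< coloured I (hi j) z >] then - theta (z.2 (lo j) 0)
  else 0.

Lemma label_lo i j z : coloured I (lo i) z ->
  label j z = if i == j then theta (z.1 0 (hi i)) else 0.
Proof.
rewrite /label => zi; case: asboolP => [zj|nzj].
  by rewrite (lo_inj (coloured_inj zi zj)) eqxx.
case: eqVneq => [ij|_]; first by subst j.
case: asboolP => // zj; have := lo_neq_hi i j.
by rewrite (coloured_inj zi zj) eqxx.
Qed.

Lemma label_hi i j z : coloured I (hi i) z ->
  label j z = if i == j then - theta (z.2 (lo i) 0) else 0.
Proof.
rewrite /label => zi; case: asboolP => [zj|_].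
  by have := lo_neq_hi j i; rewrite (coloured_inj zi zj) eqxx.
case: asboolP => [zj|nzj]; first by rewrite (hi_inj (coloured_inj zi zj)) eqxx.
by case: eqVneq => [ij|//]; subst j.
Qed.

Definition in_block j (z : vertex) :=
  coloured I (lo j) z \/ coloured I (hi j) z.

(** Adjacent vertices in one block have the two different colours of this
    block, and both see the same entry of the frame. *)
Lemma label_same_block i j z w :
  in_block i z -> in_block i w ->
  form_app z.2 w.1 = 0 -> form_app w.2 z.1 = 0 -> label j z = label j w.
Proof.
move=> [zi|zi] [wi|wi] zw0 wz0.
- by have := orthogonal_coloured zi wi wz0; rewrite eqxx.
- by rewrite (label_lo _ zi) (label_hi _ wi) (theta_orthogonal zi wi wz0).
- by rewrite (label_hi _ zi) (label_lo _ wi) (theta_orthogonal wi zi zw0).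
- by have := orthogonal_coloured zi wi wz0; rewrite eqxx.
Qed.

(** Pigeonhole: more than [k] vertices cannot lie in [k] different blocks. *)
Lemma same_block_pair s : SPB (2 * k) I s -> (k < #|` s|)%N ->
  exists z w, [/\ z \in s, w \in s, z != w & forall j, label j z = label j w].
Proof.
move=> [t [st [[_ _ dual] std] _]] ks; have sub := fsubsetP st.
have blkP z : z \in s -> exists j, in_block j z.
  move=> /sub /std [i zi]; have [j [ij|ij]] := lo_or_hi i; subst i.
    by exists j; left.
  by exists j; right.
have [z0 z0s] : exists z0, z0 \in s.
  by apply/fset0Pn; rewrite -cardfs_gt0; apply: leq_ltn_trans ks.
have [j0 _] := blkP z0 z0s.
pose blk z := odflt j0 [pick j | `[< in_block j z >]].
have blk_in z : z \in s -> in_block (blk z) z.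
  move=> /blkP[j zj]; rewrite /blk; case: pickP => [i /asboolP //|].
  by move=> /(_ j) /asboolP.
apply: contrapT => nopair; move: ks; apply/negP; rewrite -leqNgt.
have blk_inj : {in s &, injective blk}.
  move=> z w zs ws zw; apply: contrapT => /eqP zNw; apply: nopair.
  exists z, w; split=> // j; have wb := blk_in w ws; rewrite -zw in wb.
  apply: label_same_block (blk_in z zs) wb _ _.
    by rewrite dual ?sub // (negPf zNw).
  by rewrite dual ?sub // eq_sym (negPf zNw).
rewrite -(size_map blk) -[leqRHS]card_ord -[size _](card_uniqP _).
  exact: max_card.
by rewrite map_inj_in_uniq // fset_uniq.
Qed.

(** The two ends of the [j]-th axis of the cross-polytope. They have the same
    form and the same colour, and their vectors differ by [x] times a basis
    vector; the end with [x] comes first so that the difference of the labels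
    is [+1]. *)
Definition vert (j : 'I_k) (b : bool) : vertex :=
  (delta_mx 0 (lo j) + (if b then 0 else x) *: delta_mx 0 (hi j),
   delta_mx (lo j) 0).

Lemma coloured_vert j b : coloured I (lo j) (vert j b).
Proof.
split=> i l; rewrite !mxE ?subrr //= addrAC subrr add0r.
by case: b; rewrite ?mul0r //; apply: I_mul.
Qed.

Lemma label_vert i j :
  label i (vert j false) - label i (vert j true) = (i == j)%:R.
Proof.
rewrite !(label_lo _ (coloured_vert _ _)) eq_sym; case: eqP => _; last first.
  by rewrite subrr.
rewrite !mxE !eqxx /= eq_sym (negPf (lo_neq_hi j j)) !add0r mul0r mulr1.
by rewrite theta_x theta0 subr0.
Qed.

(** The rows of [1 + x *: nil_mx e] and the columns of its inverse
    [1 - x *: nil_mx e] form a frame; the vertex of colour [lo j] in this frame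
    is [vert j (e j)]. *)
Definition nil_mx (e : 'I_k -> bool) : 'M[R]_(2 * k) :=
  \sum_j (~~ e j)%:R *: delta_mx (lo j) (hi j).

Lemma nil_mx_sqr e e' : nil_mx e *m nil_mx e' = 0.
Proof.
rewrite /nil_mx mulmx_suml big1 // => i _; rewrite mulmx_sumr big1 // => j _.
rewrite -scalemxAl -scalemxAr mul_delta_mx_0 ?scaler0 //.
by rewrite eq_sym lo_neq_hi.
Qed.

(** Choosing one end on every axis gives part of a unipotent frame, so that
    all faces of the cross-polytope extend to facets. *)
Lemma vert_SPB e s :
  {subset s <= [seq vert j (e j) | j : 'I_k]} -> SPB (2 * k) I s.
Proof.
move=> se; pose N := x *: nil_mx e.
have N2 : N *m N = 0 by rewrite -scalemxAl -scalemxAr nil_mx_sqr !scaler0.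
have AB : (1%:M + N) *m (1%:M - N) = 1%:M.
  by rewrite mulmxBr mulmx1 mulmxDl mul1mx N2 addr0 addrK.
pose b i : vertex := (row i (1%:M + N), col i (1%:M - N)).
have bdual i j : form_app (b i).2 (b j).1 = (i == j)%:R.
  rewrite /form_app /= rowE colE -mulmxA [(1%:M + N) *m _]mulmxA.
  rewrite AB mul1mx.
  by rewrite mul_delta_mx_cond mulmxnE mxE eqxx eq_sym.
have N_I i j : I (N i j) by rewrite mxE; apply: I_mul.
have bcol i : coloured I i (b i).
  split=> l m; rewrite ord1 !mxE /= ?andbT.
    by rewrite eq_sym addrAC subrr add0r; apply: I_mul.
  by rewrite addrAC subrr add0r; have := I_sub I0 (N_I l i); rewrite sub0r mxE.
have vertE j : vert j (e j) = b (lo j).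
  rewrite /vert /b rowE colE; congr (_, _).
    rewrite mulmxDr mulmx1 -scalemxAr /nil_mx mulmx_sumr (bigD1 j) //= big1.
      rewrite addr0 -scalemxAr mul_delta_mx scalerA; case: (e j) => /=.
        by rewrite mulr0.
      by rewrite mulr1.
    move=> i ij; rewrite -scalemxAr mul_delta_mx_0 ?scaler0 //.
    by rewrite (inj_eq (@lo_inj k)) eq_sym.
  rewrite mulmxBl mul1mx -scalemxAl /nil_mx mulmx_suml big1 ?scaler0 ?subr0 //.
  move=> i _; rewrite -scalemxAl mul_delta_mx_0 ?scaler0 //.
  by rewrite eq_sym lo_neq_hi.
have [bface bcard] := dual_family_facet bdual bcol.
exists [fset b i | i : 'I_(2 * k)]; split=> //; apply/fsubsetP => z /se.
by move=> /mapP[j _ ->]; rewrite vertE; apply: in_imfset.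
Qed.

End Labels.

(** * Nonvanishing homology *)

(** The hypotheses on [x] are what the two halves of the theorem share: they
    hold for [p] in [Z/p^l] with [l > 1], and for [p^a] with [a > 0] in a number
    ring, where [1/p] is not integral. *)
Lemma SPB_homology_neq0 (R : comNzRingType) (p : nat) (p_prime : prime p)
    (x : R) (k : nat) :
  (exists q, x = p%:R * q) -> (forall r, x <> p%:R * x * r) ->
  exists h : reduced_homology 'F_p (SPB (2 * k.+1) (principal x)) k, h != 0.
Proof.
move=> px xNpx.
have [theta [thetaD thetaM theta_x]] := ideal_functional p_prime px xNpx.
have I_add y z : principal x y -> principal x z -> principal x (y + z).
  by move=> [r ->] [s ->]; exists (r + s); rewrite mulrDr.
have I_mul y z : principal x y -> principal x (y * z).
  by move=> [r ->]; exists (r * z); rewrite mulrA.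
have I_x : principal x x by exists 1; rewrite mulr1.
apply: (@sphere_homology_neq0 _ _ _ k (@vert R x k.+1)
          (@label R 'F_p (principal x) theta k.+1)).
- by move=> i j; apply: label_vert.
- by move=> e s; apply: vert_SPB.
by move=> s Xs cs; apply: (@same_block_pair _ _ _ theta x) => //; rewrite cs.
Qed.

(** The inverse of [p] in [K] is rational, and its integral equation, having
    integer coefficients, holds in [algC] too; there a rational algebraic
    integer is an integer. *)
Lemma prime_inv_not_integral (K : fieldExtType rat) p (y : K) :
  prime p -> p%:R * y = 1 -> ~ integralOver (intr : int -> K) y.
Proof.
move=> p_prime py1 [q q_monic qy].
have transfer (L L' : fieldType) (f : {rmorphism L -> L'}) u :
    root (map_poly intr q) (f u) = root (map_poly intr q) u.
  rewrite -(fmorph_root f) -map_poly_comp; congr root.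
  by apply: eq_map_poly => m /=; rewrite rmorph_int.
have p0 : p%:R != 0 :> rat by rewrite pnatr_eq0 -lt0n prime_gt0.
have yE : y = in_alg K (p%:R^-1).
  have pK0 : p%:R != 0 :> K.
    by apply/eqP => pK0; move/eqP: py1; rewrite pK0 mul0r eq_sym oner_eq0.
  by rewrite fmorphV rmorph_nat; apply: (mulfI pK0); rewrite py1 mulfV.
have qp : root (map_poly intr q) (p%:R^-1 : algC).
  have : root (map_poly intr q) (p%:R^-1 : rat).
    by rewrite -(transfer _ _ (in_alg K)); rewrite yE in qy.
  by rewrite -(transfer _ _ (@ratr algC)) fmorphV rmorph_nat.
have : (p%:R^-1 : algC) \in Aint.
  apply: root_monic_Aint qp _ _; first exact: monic_map.
  by apply/polyOverP => i; rewrite coef_map /= intr_int.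
move/(Cint_rat_Aint _) => /(_ _)/intrP[].
  by rewrite rpredV rpred_nat.
move=> m mE; have : (p%:Z * m)%:~R = 1 :> algC.
  by rewrite intrM -mE mulfV // pnatr_eq0 -lt0n prime_gt0.
move/eqP; rewrite -[1]/(1%:~R) eqr_int => /eqP pm1.
have : (p %| 1)%Z by apply/dvdzP; exists m; rewrite mulrC.
by rewrite dvdz1 => /eqP /= p1; move: p_prime; rewrite p1.
Qed.

Theorem theoremD (p : nat) (p_prime : prime p) :
  (forall l : nat, (1 < l)%N -> forall k : nat, (0 < k)%N ->
     exists h : reduced_homology 'F_p
                  (SPB (2 * k)%N (principal (p%:R : 'Z_(p ^ l)))) k.-1,
       h != 0) /\
  (forall (K : fieldExtType rat) (a : nat), (2 < p ^ a)%N ->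
     forall k : nat, (0 < k)%N ->
     (exists h : reduced_homology 'F_p
                   (SPB (2 * k)%N
                      (principal ((p ^ a)%:R : ring_of_integers K))) k.-1,
        h != 0) \/
     (exists h : reduced_homology 'F_p
                   (SPB (2 * k)%N.+1
                      (principal ((p ^ a)%:R : ring_of_integers K))) k.-1,
        h != 0)).
Proof.
split=> [l l_gt1|K a pa_gt2] [//|k] _.
  apply: SPB_homology_neq0 => // [|r]; first by exists 1; rewrite mulr1.
  have pl_gt1 : (1 < p ^ l)%N.
    by rewrite -(exp1n l) ltn_exp2r ?prime_gt1 // ltnW.
  rewrite -[r]natr_Zp -!natrM => /(congr1 (@nat_of_ord _)).
  rewrite !(val_Zp_nat pl_gt1) => /(congr1 (modn^~ (p ^ 2)%N)) /=.
  rewrite !modn_dvdm ?dvdn_exp2l // mulnn modnMr modn_small; last first.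
    by rewrite -[ltnLHS]expn1 ltn_exp2l ?prime_gt1.
  by move=> p0; move: p_prime; rewrite p0.
left; case: a pa_gt2 => [|a] // _.
apply: SPB_homology_neq0 => // [|r /(congr1 val)].
  by exists (p ^ a)%:R; rewrite -natrM expnS.
rewrite !rmorphM !rmorph_nat /= => E.
have pa0 : (p ^ a.+1)%:R != 0 :> K.
  rewrite -(rmorph_nat (in_alg K)) fmorph_eq0 pnatr_eq0 -lt0n.
  by rewrite expn_gt0 prime_gt0.
have /(prime_inv_not_integral p_prime) : p%:R * val r = 1.
  by apply: (mulfI pa0); rewrite mulr1 [RHS]E mulrCA mulrA.
by apply; apply/asboolP; exact: valP r.
Qed.
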